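(* Let $X,Y$ be nonempty sets, and let $F\colon X^*\to Y$ and $G\colon X^*\to Y$ be preassociative and unarily quasi-range-idempotent functions such that $F_0=G_0$, $F_1=G_1$, and $F_2=G_2$. Then $F=G$.
   Context: $X^*=\bigcup_{n\geqslant 0}X^n$ is the set of all finite strings over $X$ (vectors in $X^n$ are regarded as strings of length $n$), with $X^0=\{\varepsilon\}$, where $\varepsilon$ is the empty string. Concatenation is denoted by juxtaposition, and $\varepsilon$ is neutral for it. For a function $F\colon X^*\to Y$, $F_n=F|_{X^n}$ and $F^{\flat}=F|_{X^*\setminus\{\varepsilon\}}$. $F$ is preassociative if for all $\mathbf{x},\mathbf{y},\mathbf{y}',\mathbf{z}\in X^*$, $F(\mathbf{y})=F(\mathbf{y}')$ implies $F(\mathbf{x}\mathbf{y}\mathbf{z})=F(\mathbf{x}\mathbf{y}'\mathbf{z})$. $F$ is unarily quasi-range-idempotent if $\mathrm{ran}(F_1)=\mathrm{ran}(F^{\flat})$, where $\mathrm{ran}$ denotes the range. *)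

(* Defs.v *)
From mathcomp Require Import all_boot.
From mathcomp Require Import boolp classical_sets.

Set Implicit Arguments.
Unset Strict Implicit.
Unset Printing Implicit Defensive.

Local Open Scope classical_set_scope.

(* The set X^* of strings over X is [seq X]; the empty string is [::] and
   concatenation is [++]. *)

(* F_n, the restriction of F to X^n *)
Definition arity_part (X Y : Type) (n : nat) (F : seq X -> Y) : n.-tuple X -> Y :=
  fun s => F (tval s).
Arguments arity_part {X Y} n F s.

(* F^flat, the restriction of F to X^* minus the empty string *)
Definition flat_part (X Y : Type) (F : seq X -> Y) : {s : seq X | s <> [::]} -> Y :=
  fun s => F (sval s).

Definition preassociative (X Y : Type) (F : seq X -> Y) : Prop :=
  forall x y y' z : seq X, F y = F y' -> F (x ++ y ++ z) = F (x ++ y' ++ z).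

Definition unarily_quasi_range_idempotent (X Y : Type) (F : seq X -> Y) : Prop :=
  range (arity_part 1 F) = range (flat_part F).

(* Main.v *)
(* Quasi-range-idempotence replaces a nonempty tail [t] of [x :: t] by a single
   letter [z] with [F t = F [:: z]]; preassociativity then gives
   [F (x :: t) = F [:: x; z]], so [F] is determined by its parts of arity at
   most two, by induction on the length of the string. *)
Require Import Defs.
From mathcomp Require Import all_boot.
From mathcomp Require Import boolp classical_sets.

Set Implicit Arguments.
Unset Strict Implicit.
Unset Printing Implicit Defensive.

Lemma arity_part_eq (X Y : Type) (n : nat) (F G : seq X -> Y) (s : n.-tuple X) :
  arity_part n F = arity_part n G -> F s = G s.
Proof. by move=> /(congr1 (@^~ s)). Qed.

Lemma uqri_letter (X Y : Type) (F : seq X -> Y) (s : seq X) :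
  unarily_quasi_range_idempotent F -> s <> [::] -> exists z, F s = F [:: z].
Proof.
move=> uqriF s_neq0.
have : range (flat_part F) (F s) by exists (exist _ s s_neq0).
(* The value is now attained on a 1-tuple, whose size proof excludes every shape but [[:: z]]. *)
by rewrite -uqriF => -[[[|z []] // size_u] _ <-]; exists z.
Qed.

(** Preassociativity with prefix [[:: x]] and empty suffix. *)
Lemma preassociative_cons (X Y : Type) (F : seq X -> Y) (x : X) (s t : seq X) :
  preassociative F -> F s = F t -> F (x :: s) = F (x :: t).
Proof. by move=> preF /(preF [:: x] _ _ [::]); rewrite !cats0. Qed.

Theorem proposition4p7 (X Y : Type) (hX : inhabited X) (hY : inhabited Y)
    (F G : seq X -> Y)
    (preF : preassociative F) (preG : preassociative G)
    (uqriF : unarily_quasi_range_idempotent F)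
    (uqriG : unarily_quasi_range_idempotent G)
    (eq0 : arity_part 0 F = arity_part 0 G)
    (eq1 : arity_part 1 F = arity_part 1 G)
    (eq2 : arity_part 2 F = arity_part 2 G) :
  F = G.
Proof.
apply/funext; elim=> [|x [|y t] IH]; first exact: (arity_part_eq [tuple] eq0).
  exact: (arity_part_eq [tuple x] eq1).
have [//|z Fz] := uqri_letter (s := y :: t) uqriF.
(* The letter [z] chosen for [F] also serves [G]: by [IH] both functions agree on the shorter string
   [y :: t], and by [eq1] they agree on [[:: z]]. *)
have Gz : G (y :: t) = G [:: z].
  by rewrite -IH Fz; exact: (arity_part_eq [tuple z] eq1).
rewrite (preassociative_cons x preF Fz) (preassociative_cons x preG Gz).
exact: (arity_part_eq [tuple x; z] eq2).
Qed.
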